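(* Let $n\ge2$ and let $\mathbf v\in R_0$ be a vector field on $\mathbb R^n$. Then the distribution $D\mathbf v-D^t\mathbf v$ belongs to $L^\infty(\mathbb R^n)$, and $$\|D\mathbf v-D^t\mathbf v\|_{L^\infty}\le C\,\|\mathbf v\|_{R_0}$$ for some constant $C>0$ depending only on $n$.
   Context: Class $R_0$: a continuous $\mathbf v:\mathbb R^n\to\mathbb R^n$ belongs to $R_0$ if there is $C_0\ge 0$ such that for every $x\in\mathbb R^n$ and all $h,k\in\mathbb R^n$ with $|h|=|k|\ne0$, $$\left|\frac{\langle\mathbf v(x+h)-\mathbf v(x),k\rangle}{|h||k|}-\frac{\langle\mathbf v(x+k)-\mathbf v(x),h\rangle}{|h||k|}\right|\le C_0 .$$ The best constant $C_0$ is denoted $\|\mathbf v\|_{R_0}$. Here $D\mathbf v$ is the (distributional) Jacobian matrix of $\mathbf v$ and $D^t\mathbf v$ its transpose. *)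

(* Defs.v *)
From HB Require Import structures.
From mathcomp Require Import all_boot all_order all_algebra.
From mathcomp Require Import all_classical all_reals all_analysis.

Set Implicit Arguments.
Unset Strict Implicit.
Unset Printing Implicit Defensive.
Import Order.TTheory GRing.Theory Num.Theory.
Import numFieldNormedType.Exports.

Local Open Scope classical_set_scope.
Local Open Scope ring_scope.

(* R^n is 'rV[R]_n. Its library norm `|x| is the sup norm: it supplies the    *)
(* topology, while lengths are measured by [enorm].                           *)
Section euclidean.
Context {R : realType}.

Definition dotp {n} (x y : 'rV[R]_n) : R := \sum_(i < n) x 0 i * y 0 i.

Definition enorm {n} (x : 'rV[R]_n) : R := Num.sqrt (dotp x x).

Definition frob {m n} (A : 'M[R]_(m, n)) : R :=
  Num.sqrt (\sum_(i < m) \sum_(j < n) A i j ^+ 2).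

End euclidean.

(* The sigma-algebra on R^n is generated by the coordinates, as the library   *)
(* does for n.-tuple; it is the Borel one.                                    *)
Section measurable_rV.
Context {R : realType} (n : nat).

Let coors : 'I_n -> 'rV[R]_n -> R := fun i x => x 0 i.

Let rV_set0 : g_sigma_preimage coors set0.
Proof. exact: sigma_algebra0. Qed.

Let rV_setC A : g_sigma_preimage coors A -> g_sigma_preimage coors (~` A).
Proof. exact: sigma_algebraC. Qed.

Let rV_bigcup (F : (set 'rV[R]_n)^nat) :
  (forall i, g_sigma_preimage coors (F i)) ->
  g_sigma_preimage coors (\bigcup_i (F i)).
Proof. exact: sigma_algebra_bigcup. Qed.

Definition rV_display : measure_display. Proof. exact. Qed.

HB.instance Definition _ := @isMeasurable.Build rV_display
  'rV[R]_n (g_sigma_preimage coors) rV_set0 rV_setC rV_bigcup.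

End measurable_rV.

Section lebesgue_rV.
Context {R : realType}.
Local Open Scope ereal_scope.

Definition rV_cons n (p : measurableTypeR R * 'rV[R]_n) : 'rV[R]_n.+1 :=
  row_mx (p.1%:M : 'rV[R]_1) p.2.

Lemma measurable_coord n (i : 'I_n) :
  measurable_fun [set: 'rV[R]_n] (fun x : 'rV[R]_n => x ord0 i : R).
Proof.
move=> _ Y mY; rewrite setTI; apply: sub_sigma_algebra => /=.
rewrite -bigcup_seq/=; exists i => /=; first by rewrite mem_index_enum.
by exists Y => //; rewrite setTI.
Qed.

Lemma measurable_rVP d (T : measurableType d) n (f : T -> 'rV[R]_n) :
  (forall i, measurable_fun [set: T] (fun t => f t ord0 i)) ->
  measurable_fun [set: T] f.
Proof.
move=> mf.
suff: g_sigma_preimage (fun i => (fun x : 'rV[R]_n => x ord0 i) \o f)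
    `<=` measurable.
  rewrite g_sigma_preimage_comp => prefS.
  by move=> _ A mA; apply: prefS; exists A.
apply: smallest_sub; first exact: sigma_algebra_measurable.
case: n f mf => [|n] f mf; first by rewrite big_ord0.
rewrite -bigcup_mkord_ord; apply: bigcup_sub => i Ii.
by move=> A [B mB <-]; exact: mf.
Qed.

Lemma rV_cons0 n p : @rV_cons n p ord0 ord0 = p.1.
Proof.
transitivity (rV_cons p ord0 (lshift n (ord0 : 'I_1))).
  by congr (rV_cons p _ _); exact: val_inj.
by rewrite [LHS]row_mxEl mxE eqxx.
Qed.

Lemma rV_consS n p (j : 'I_n) : @rV_cons n p ord0 (lift ord0 j) = p.2 ord0 j.
Proof.
transitivity (rV_cons p ord0 (rshift 1 j)).
  by congr (rV_cons p _ _); exact: val_inj.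
by rewrite [LHS]row_mxEr.
Qed.

Lemma measurable_rV_cons n : measurable_fun setT (@rV_cons n).
Proof.
apply: measurable_rVP => i; case: (unliftP ord0 i) => [j|] ->.
  under eq_fun do rewrite rV_consS.
  apply: (measurableT_comp (f := fun x : 'rV[R]_n => x ord0 j : R)) => //.
  exact: measurable_coord.
under eq_fun do rewrite rV_cons0.
exact: measurable_fst.
Qed.

Definition rV_uncons n (x : 'rV[R]_n.+1) : measurableTypeR R * 'rV[R]_n :=
  (x ord0 ord0, \row_j x ord0 (lift ord0 j)).

Lemma measurable_rV_uncons n : measurable_fun setT (@rV_uncons n).
Proof.
apply/measurable_fun_pairP; split.
  exact: (@measurable_coord n.+1 ord0).
apply: measurable_rVP => i.
rewrite (_ : (fun _ => _) = fun x : 'rV[R]_n.+1 => x ord0 (lift ord0 i)).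
  exact: measurable_coord.
by apply/funext => x /=; rewrite mxE.
Qed.

Lemma rV_consK n : cancel (@rV_cons n) (@rV_uncons n).
Proof.
move=> p; rewrite /rV_uncons rV_cons0 [RHS]surjective_pairing; congr pair.
by apply/rowP => j; rewrite mxE rV_consS.
Qed.

Section step.
Variables (n : nat) (mu : {sigma_finite_measure set 'rV[R]_n -> \bar R}).

Definition lebesgue_rVS : set 'rV[R]_n.+1 -> \bar R :=
  pushforward ((@lebesgue_measure R) \x mu) (@rV_cons n).

Let preimage_meas A :
  measurable A -> measurable (@rV_cons n @^-1` A).
Proof. by move=> mA; rewrite -[X in measurable X]setTI; exact: measurable_rV_cons. Qed.

Let step0 : lebesgue_rVS set0 = 0.
Proof. by rewrite /lebesgue_rVS /pushforward preimage_set0 measure0. Qed.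

Let step_ge0 A : 0 <= lebesgue_rVS A.
Proof. by rewrite /lebesgue_rVS /pushforward; exact: measure_ge0. Qed.

Let step_sigma_additive : semi_sigma_additive lebesgue_rVS.
Proof.
move=> F mF tF mUF; rewrite /lebesgue_rVS /pushforward preimage_bigcup.
apply: measure_semi_sigma_additive.
- by move=> k; exact: preimage_meas.
- apply/trivIsetP => /= i j _ _ ij; rewrite -preimage_setI.
  by move/trivIsetP : tF => /(_ _ _ _ _ ij) ->//; rewrite preimage_set0.
- by rewrite -preimage_bigcup; exact: preimage_meas.
Qed.

HB.instance Definition _ :=
  isMeasure.Build _ _ _ lebesgue_rVS step0 step_ge0 step_sigma_additive.

Let step_sigma_finite : sigma_finite setT lebesgue_rVS.
Proof.
have /sigma_finiteP[F [TF ndF Foo]] := sigma_finiteT (@lebesgue_measure R).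
have /sigma_finiteP[G [TG ndG Goo]] := sigma_finiteT mu.
exists (fun k => @rV_uncons n @^-1` (F k `*` G k)).
  rewrite -preimage_bigcup; suff <- : [set: _] = \bigcup_k (F k `*` G k) by [].
  rewrite -setXTT TF TG predeqE => -[x y]; split.
    move=> [/= [i _ Fix] [k _ Gky]]; exists (maxn i k) => //; split.
    - by move: x Fix; exact/subsetPset/ndF/leq_maxl.
    - by move: y Gky; exact/subsetPset/ndG/leq_maxr.
  by move=> [i _ []/= ? ?]; split; exists i.
move=> k; have [mF Fk] := Foo k; have [mG Gk] := Goo k; split.
  rewrite -[X in measurable X]setTI.
  by apply: measurable_rV_uncons => //; exact: measurableX.
rewrite /lebesgue_rVS /pushforward -comp_preimage.
rewrite (_ : _ \o _ = id) ?preimage_id; last first.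
  by apply/funext => p /=; rewrite rV_consK.
by rewrite product_measure1E// lte_mul_pinfty// ge0_fin_numE.
Qed.

HB.instance Definition _ :=
  Measure_isSigmaFinite.Build _ _ _ lebesgue_rVS step_sigma_finite.

End step.

(* The n-fold product of the one-dimensional Lebesgue measure; R^0 is a       *)
(* point, of mass 1.                                                          *)
Fixpoint lebesgue_rV n : {sigma_finite_measure set 'rV[R]_n -> \bar R} :=
  match n with
  | 0%N => \d_(0 : 'rV[R]_0)%R
  | n'.+1 => lebesgue_rVS (lebesgue_rV n')
  end.

End lebesgue_rV.
Arguments lebesgue_rV {R} n.

Section distributions.
Context {R : realType} {n : nat}.
Implicit Types (phi : 'rV[R]_n -> R) (v : 'rV[R]_n -> 'rV[R]_n).

Definition partial (i : 'I_n) phi : 'rV[R]_n -> R :=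
  fun x => 'D_(delta_mx ord0 i) phi x.

(* Every iterated partial derivative is differentiable, hence continuous.     *)
Definition smooth phi : Prop :=
  forall (s : seq 'I_n) (x : 'rV[R]_n), differentiable (foldr partial phi s) x.

Definition test_function phi : Prop :=
  smooth phi /\ compact (closure [set x | phi x != 0]).

(* A distribution is given by its values on test functions; matrix-valued     *)
(* ones are matrices of scalar ones. The (i, j) entry of the distributional   *)
(* Jacobian is the distribution d_j v_i.                                      *)
Definition jacobian_distr v : ('rV[R]_n -> R) -> 'M[R]_n :=
  fun phi => \matrix_(i, j)
    - \int[lebesgue_rV n]_x (v x ord0 i * partial j phi x).

Definition skew_jacobian_distr v : ('rV[R]_n -> R) -> 'M[R]_n :=
  fun phi => jacobian_distr v phi - (jacobian_distr v phi)^T.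

Definition distr_repr (T : ('rV[R]_n -> R) -> 'M[R]_n)
    (g : 'rV[R]_n -> 'M[R]_n) : Prop :=
  forall phi, test_function phi ->
    T phi = \matrix_(i, j) \int[lebesgue_rV n]_x (g x i j * phi x).

Definition Linfty_mx (g : 'rV[R]_n -> 'M[R]_n) : Prop :=
  forall i j, (fun x => g x i j) \in Lfun (lebesgue_rV n) +oo%E.

Definition Linfty_norm (g : 'rV[R]_n -> 'M[R]_n) : \bar R :=
  Lnorm (lebesgue_rV n) +oo%E (fun x => (frob (g x))%:E).

End distributions.

Section R0_class.
Context {R : realType} {n : nat}.
Implicit Type v : 'rV[R]_n -> 'rV[R]_n.

Definition R0_bound v (C : R) : Prop :=
  forall x h k : 'rV[R]_n, enorm h = enorm k -> enorm h != 0 ->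
    `| dotp (v (x + h) - v x) k / (enorm h * enorm k)
       - dotp (v (x + k) - v x) h / (enorm h * enorm k) | <= C.

Definition R0 v : Prop :=
  continuous v /\ exists2 C : R, 0 <= C & R0_bound v C.

Definition R0_norm v : R := inf [set C : R | 0 <= C /\ R0_bound v C].

End R0_class.

(* Main.v *)
(* Testing the R_0 condition with h = r e_j and k = r e_i bounds the difference
   quotient ((v_i(x + r e_j) - v_i(x)) - (v_j(x + r e_i) - v_j(x))) / r by
   |v|_{R_0}, uniformly in x and r. By translation invariance of the Lebesgue
   measure, the difference quotient is carried over to the test function, so as
   r -> 0 these functions converge to d_j v_i - d_i v_j as distributions. A
   bounded sequence in L^oo has a weak-* limit point with the same bound, which
   represents the limit distribution.

   The weak-* limit is obtained without L^1 duality: near-minimizers of a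
   weighted L^2 norm over the convex hulls of the tails of the sequence are
   Cauchy by the parallelogram identity, hence (with a fast enough rate)
   converge almost everywhere, and dominated convergence applies. *)
Require Import Defs.
From mathcomp Require Import all_boot all_order all_algebra.
From mathcomp Require Import all_classical all_reals all_analysis.
From mathcomp Require Import measurable_realfun ess_sup_inf.
From mathcomp Require Import ring lra.
Import Order.TTheory GRing.Theory Num.Theory.
Import numFieldNormedType.Exports.

Local Open Scope classical_set_scope.
Local Open Scope ring_scope.

(** * Weak-* limit points of uniformly bounded sequences on a sigma-finite space *)

Section weak_star_compactness.
Set Implicit Arguments.
Unset Strict Implicit.
Context d (T : measurableType d) (R : realType).

(** Sum and integral commute for nonnegative terms, and the bounds add up to [e]. It serves both for
    the construction of a weight and for almost everywhere convergence. *)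
Lemma integrable_nneseries (mu : {measure set T -> \bar R}) (h : nat -> T -> R)
    (e : R) :
  0 <= e ->
  (forall k, measurable_fun [set: T] (h k)) ->
  (forall k x, 0 <= h k x) ->
  (forall k, (\int[mu]_x (h k x)%:E <= (e / (2 ^ k.+1)%:R)%:E)%E) ->
  mu.-integrable [set: T] (fun x => \sum_(k <oo) (h k x)%:E)%E.
Proof.
move=> e0 mh h0 hi; apply/integrableP; split.
  apply: (@ge0_emeasurable_sum _ _ _ _ (fun k x => (h k x)%:E) predT).
    by move=> k x _ _; rewrite lee_fin.
  by move=> k _; exact/measurable_EFinP.
under eq_integral.
  move=> x _; rewrite gee0_abs; last first.
    by apply: nneseries_ge0 => k _ _; rewrite lee_fin.
  over.
rewrite integral_nneseries//; last 2 first.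
  by move=> k; exact/measurable_EFinP.
  by move=> k x _; rewrite lee_fin.
apply: (@le_lt_trans _ _ e%:E); last exact: ltry.
apply: (le_trans _ (epsilon_trick0 predT e0)).
apply: lee_nneseries => // k _ _.
by apply: integral_ge0 => x _; rewrite lee_fin.
Qed.

(** A summable combination of indicators of sets of finite measure covering the space. The weight
    puts all bounded functions into a weighted [L^2], even when [mu] is infinite. *)
Lemma sigma_finite_weight (mu : {sigma_finite_measure set T -> \bar R}) :
  exists w : T -> R, [/\ measurable_fun [set: T] w, forall x, 0 < w x
    & mu.-integrable [set: T] (EFin \o w)].
Proof.
have /sigma_finiteP[F [TF _ Foo]] := sigma_finiteT mu.
(* The first factor makes the integral of [h k] at most [1 / 2 ^ k.+1]; the added [1] also keeps
   [c k] below this bound, so the series converges at every point. *)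
pose c k : R := (1 + fine (mu (F k)))^-1 / (2 ^ k.+1)%:R.
have c1 k : 0 < 1 + fine (mu (F k)) by rewrite ltr_pwDl// fine_ge0.
have e1 k : 0 < (2 ^ k.+1)%:R :> R by rewrite ltr0n expn_gt0.
have c0 k : 0 < c k by rewrite /c divr_gt0// invr_gt0.
pose h k x : R := c k * \1_(F k) x.
have h0 k x : 0 <= h k x by rewrite /h mulr_ge0// ltW.
have mh k : measurable_fun [set: T] (h k).
  by apply: measurable_funM => //; apply: measurable_indic; exact: (Foo k).1.
have [mF Fy] : (forall k, measurable (F k)) /\ (forall k, mu (F k) < +oo)%E.
  by split=> k; have [] := Foo k.
have ih : mu.-integrable [set: T] (fun x => \sum_(k <oo) (h k x)%:E)%E.
  apply: (@integrable_nneseries _ _ 1) => // k.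
  under eq_integral do rewrite /h EFinM.
  rewrite ge0_integralZl//; last 2 first.
  - by apply/measurable_EFinP; apply: measurable_indic.
  - by rewrite lee_fin ltW.
  rewrite integral_indic// setIT -[X in (_ * X)%E]fineK; last first.
    by rewrite ge0_fin_numE//; exact: Fy.
  rewrite -EFinM lee_fin /c mul1r mulrAC ler_piMl ?invr_ge0 ?ler0n//.
  by rewrite mulrC ler_pdivrMr// mul1r lerDr.
have hub x : (\sum_(k <oo) (h k x)%:E < +oo)%E.
  apply: (@le_lt_trans _ _ 1%:E); last exact: ltry.
  apply: (le_trans _ (epsilon_trick0 predT ler01)).
  apply: lee_nneseries => [k _ _|k _]; first by rewrite lee_fin.
  rewrite lee_fin /h (le_trans (_ : _ <= c k))//.
    by rewrite ler_piMr ?(ltW (c0 k))// indicE lern1 leq_b1.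
  by rewrite /c ler_pM2r ?invr_gt0// invf_le1// lerDl fine_ge0.
have hfin x : (\sum_(k <oo) (h k x)%:E)%E \is a fin_num.
  by rewrite ge0_fin_numE//; apply: nneseries_ge0 => k _ _; rewrite lee_fin.
pose w x := fine (\sum_(k <oo) (h k x)%:E)%E.
have wE : EFin \o w = (fun x => \sum_(k <oo) (h k x)%:E)%E.
  by apply/funext => x; rewrite /w /= fineK.
exists w; split.
- by apply/measurable_EFinP; rewrite wE; exact: measurable_int ih.
- move=> x; have [k _ Fx] : (\bigcup_i F i) x by rewrite -TF.
  rewrite -lte_fin fineK//.
  apply: (@lt_le_trans _ _ (h k x)%:E).
    by rewrite lte_fin /h indicE mem_set// mulr1.
  apply: (@le_trans _ _ (\sum_(0 <= i < k.+1) (h i x)%:E)%E).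
    by rewrite big_nat_recr//= leeDr// sume_ge0// => i _; rewrite lee_fin.
  by apply: nneseries_lim_ge => i _ _; rewrite lee_fin.
- by rewrite wE.
Qed.


Lemma cvg_Rintegral_dominated (mu : {measure set T -> \bar R})
    (f_ : nat -> T -> R) (f g : T -> R) :
  (forall k, measurable_fun [set: T] (f_ k)) ->
  measurable_fun [set: T] f ->
  {ae mu, forall x, f_ ^~ x @ \oo --> f x} ->
  mu.-integrable [set: T] (EFin \o g) ->
  (forall k x, `|f_ k x| <= g x) ->
  mu.-integrable [set: T] (EFin \o f) /\
  \int[mu]_x f_ k x @[k --> \oo] --> \int[mu]_x f x.
Proof.
move=> mf_ mf cf ig fg.
have [|||||fi _ cfi] := @dominated_convergence _ _ _ mu _ measurableT
    (fun k => EFin \o f_ k) (EFin \o f) (EFin \o g).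
- by move=> k; exact/measurable_EFinP.
- exact/measurable_EFinP.
- by apply: filterS cf => x fx _; apply: cvg_EFin => //; exact: nearW.
- exact: ig.
- by apply: nearW => x k _; rewrite /= lee_fin.
split=> //; apply: fine_cvg; rewrite fineK; last exact: integrable_fin_num.
exact: cfi.
Qed.

Lemma integrable_bounded_mul (mu : {measure set T -> \bar R}) (phi f : T -> R)
    (M : R) :
  measurable_fun [set: T] f -> (forall x, `|f x| <= M) ->
  mu.-integrable [set: T] (EFin \o phi) ->
  mu.-integrable [set: T] (EFin \o (fun x => f x * phi x)).
Proof.
move=> mf fM iphi.
have mphi : measurable_fun [set: T] phi.
  by apply/measurable_EFinP; exact: measurable_int iphi.
apply: (@le_integrable _ _ _ _ _ measurableT _ (EFin \o (fun x => M * phi x))).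
- by apply/measurable_EFinP; exact: measurable_funM.
- move=> x _; rewrite /= lee_fin !normrM ler_wpM2r//.
  exact: le_trans (fM x) (ler_norm M).
- have -> : EFin \o (fun x => M * phi x) = (fun x => M%:E * (EFin \o phi) x)%E.
    by apply/funext => x; rewrite /= EFinM.
  exact: integrableZl.
Qed.

(** Each term is at most the sum [S], so the increments of [a] are at most a constant times
    [2^-1 ^+ k], and the telescoping series converges absolutely. *)
Lemma cvg_of_weighted_increments (a : nat -> R) (w : R) :
  0 < w ->
  (\sum_(k <oo) (4 ^+ k * (w * (a k - a k.+1) ^+ 2))%:E)%E \is a fin_num ->
  cvgn a.
Proof.
move=> w0 sfin.
pose S := fine (\sum_(k <oo) (4 ^+ k * (w * (a k - a k.+1) ^+ 2))%:E)%E.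
have t0 k : 0 <= 4 ^+ k * (w * (a k - a k.+1) ^+ 2).
  by rewrite mulr_ge0 ?exprn_ge0// mulr_ge0 ?sqr_ge0// ltW.
have tS k : 4 ^+ k * (w * (a k - a k.+1) ^+ 2) <= S.
  rewrite -lee_fin fineK//.
  apply: (@le_trans _ _ (\sum_(0 <= i < k.+1)
      (4 ^+ i * (w * (a i - a i.+1) ^+ 2))%:E)%E).
    by rewrite big_nat_recr//= leeDr// sume_ge0// => i _; rewrite lee_fin.
  by apply: nneseries_lim_ge => i _ _; rewrite lee_fin.
have S0 : 0 <= S by exact: le_trans (t0 0%N) (tS 0%N).
(* Chosen so that [S / w <= B ^+ 2], which avoids a square root. *)
pose B := S / w + 1.
have B0 : 0 <= B by rewrite addr_ge0// divr_ge0// ltW.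
have ak k : `|a k.+1 - a k| <= geometric B 2^-1 k.
  rewrite /geometric /= exprVn ler_pdivlMr ?exprn_gt0//.
  rewrite -(@ler_pXn2r _ 2)// ?nnegrE ?mulr_ge0// ?exprn_ge0//.
  rewrite distrC exprMn -exprM mulnC exprM -normrX ger0_norm ?sqr_ge0//.
  have -> : (2 ^+ 2 : R) = 4 by rewrite -natrX.
  apply: (@le_trans _ _ (S / w)).
    rewrite ler_pdivlMr// (_ : _ * w = 4 ^+ k * (w * (a k - a k.+1) ^+ 2))//.
    by ring.
  rewrite /B; have : 0 <= S / w by rewrite divr_ge0// ltW.
  by nra.
have cs : cvgn (series (telescope a)).
  apply: normed_cvg; apply: (@series_le_cvg _ _ (geometric B 2^-1)) => //.
  - by move=> k /=.
  - by move=> k; rewrite /geometric/= mulr_ge0// exprn_ge0// invr_ge0.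
  - apply: is_cvg_geometric_series.
    by rewrite ger0_norm ?invr_ge0// invf_lt1// ltr1n.
rewrite (_ : a = (fun k => a 0%N + series (telescope a) k)); last first.
  by apply/funext => k; rewrite -eq_sum_telescope.
by apply: is_cvgD => //; exact: is_cvg_cst.
Qed.

Lemma integrable_scale (mu : {measure set T -> \bar R}) (a : R) (f : T -> R) :
  mu.-integrable [set: T] (EFin \o f) ->
  mu.-integrable [set: T] (EFin \o (fun x => a * f x)).
Proof.
move=> fi; rewrite [X in integrable _ _ X](_ : _ =
  (fun x => a%:E * (EFin \o f) x)%E)//.
exact: integrableZl.
Qed.

(** * Energy minimization over the hulls of the tails *)

Section bounded_sequence.
Implicit Types f g h : T -> R.
Variables (mu : {sigma_finite_measure set T -> \bar R}).
Variables (u : nat -> T -> R) (C : R).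
Hypothesis mu_u : forall k, measurable_fun [set: T] (u k).
Hypothesis uC : forall k x, `|u k x| <= C.

(** A point of [T] is asked for because on an empty space [uC] says nothing about the sign of
    [C]. *)
Let C0 : T -> 0 <= C.
Proof. by move=> x; exact: le_trans (uC 0%N x). Qed.

(* A substitute for the closed convex hull of the tail [u m, u m.+1, ...]: the
   functions whose pairing with any [phi] is as close to any [L] as those of the
   tail are. *)
Let tail_hull m (f : T -> R) := [/\ measurable_fun [set: T] f,
  forall x, `|f x| <= C &
  forall phi (L e : R), mu.-integrable [set: T] (EFin \o phi) ->
    (forall k, (m <= k)%N -> `|\int[mu]_x (u k x * phi x) - L| <= e) ->
    `|\int[mu]_x (f x * phi x) - L| <= e].

Let mid (f g : T -> R) x := 2^-1 * f x + 2^-1 * g x.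

Let tail_hull_u m k : (m <= k)%N -> tail_hull m (u k).
Proof. by move=> mk; split=> // phi L e _; exact. Qed.

Let tail_hullS m m' f : (m <= m')%N -> tail_hull m' f -> tail_hull m f.
Proof.
move=> mm' [mf fC fP]; split=> // phi L e iphi H; apply: fP => // k m'k.
by apply: H; exact: leq_trans m'k.
Qed.

(** The bounds confine values and pairings to intervals, which are convex. *)
Let tail_hull_mid m f g : tail_hull m f -> tail_hull m g ->
  tail_hull m (mid f g).
Proof.
move=> [mf fC fP] [mg gC gP]; split.
- by apply: measurable_funD; apply: measurable_funM.
- move=> x; rewrite /mid (le_trans (ler_normD _ _))// !normrM.
  by rewrite ger0_norm ?invr_ge0//; have := fC x; have := gC x; lra.
- move=> phi L e iphi H.
  have if_ := integrable_bounded_mul mf fC iphi.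
  have ig_ := integrable_bounded_mul mg gC iphi.
  have := fP phi L e iphi H; have := gP phi L e iphi H.
  have -> : \int[mu]_x (mid f g x * phi x) =
      2^-1 * \int[mu]_x (f x * phi x) + 2^-1 * \int[mu]_x (g x * phi x).
    rewrite -!RintegralZl// -RintegralD//; last 2 first.
    + exact: integrable_scale.
    + exact: integrable_scale.
    by apply: eq_Rintegral => x _; rewrite /mid mulrDl !mulrA.
  by rewrite !ler_norml => /andP[? ?] /andP[? ?]; apply/andP; split; lra.
Qed.

Variable w : T -> R.
Hypothesis w0 : forall x, 0 < w x.
Hypothesis iw : mu.-integrable [set: T] (EFin \o w).

(** The squared norm of the [L^2] space with weight [w], finite on bounded measurable functions
    since [w] is integrable. *)
Let energy (f : T -> R) : R := \int[mu]_x (f x ^+ 2 * w x).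

Let integrable_energy f (M : R) : measurable_fun [set: T] f ->
  (forall x, `|f x| <= M) ->
  mu.-integrable [set: T] (EFin \o (fun x => f x ^+ 2 * w x)).
Proof.
move=> mf fM; apply: (@integrable_bounded_mul _ _ _ (M ^+ 2)) => //.
  exact: measurable_funX.
move=> x; rewrite normrX ler_pXn2r// nnegrE//.
exact: le_trans (fM x).
Qed.

Let energy_ge0 f : 0 <= energy f.
Proof.
by apply: Rintegral_ge0 => x _; rewrite mulr_ge0 ?sqr_ge0// ltW.
Qed.

(** A pointwise identity integrated against [w]; hull membership makes the energies finite. The
    indices differ since the functions compared later come from different tails. *)
Let energy_parallelogram m m' f g : tail_hull m f -> tail_hull m' g ->
  energy (fun x => f x - g x) =
    2 * energy f + 2 * energy g - 4 * energy (mid f g).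
Proof.
move=> Kf Kg.
have Km := tail_hull_mid (tail_hullS (leq0n _) Kf) (tail_hullS (leq0n _) Kg).
have [mf fC _] := Kf; have [mg gC _] := Kg; have [mm mC _] := Km.
have if_ := integrable_energy mf fC.
have ig_ := integrable_energy mg gC.
have im_ := integrable_energy mm mC.
rewrite /energy -!RintegralZl// -RintegralD//; [|exact: integrable_scale..].
rewrite -RintegralB//.
- by apply: eq_Rintegral => x _; rewrite /mid; field.
- exact: (integrableD measurableT (integrable_scale 2 if_)
    (integrable_scale 2 ig_)).
- exact: integrable_scale.
Qed.

(** The infimum of the energy over the hull of the tail from [m] increases with [m] and stays below
    [M]; [D] is the supremum of these infima. *)
Let near_minimizers : exists D : R, forall k e, 0 < e ->
  exists f N, [/\ (k <= N)%N, tail_hull N f, energy f <= D + e &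
    forall h, tail_hull N h -> D - e <= energy h].
Proof.
pose E m := [set energy f | f in tail_hull m].
have E0 m : E m !=set0.
  by exists (energy (u m)); exists (u m) => //; exact: tail_hull_u.
have lbE m : lbound (E m) 0 by move=> _ [f _ <-]; exact: energy_ge0.
have hlb m : has_lbound (E m) by exists 0.
have infE m k : (m <= k)%N -> inf (E m) <= energy (u k).
  by move=> mk; apply: ge_inf => //; exists (u k) => //; exact: tail_hull_u.
pose M := C ^+ 2 * \int[mu]_x w x.
have eM k : energy (u k) <= M.
  rewrite /M -RintegralZl//; apply: le_Rintegral => //.
  - exact: integrable_energy (mu_u k) (uC k).
  - exact: integrable_scale.
  - move=> x _; rewrite ler_wpM2r ?(ltW (w0 x))//.
    rewrite -[leLHS]ger0_norm ?sqr_ge0// normrX ler_pXn2r// nnegrE//.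
    exact: C0.
have infM m : inf (E m) <= M by exact: le_trans (infE m m (leqnn m)) (eM m).
have inf_nd m m' : (m <= m')%N -> inf (E m) <= inf (E m').
  move=> mm'; apply: lb_le_inf => // _ [f Kf <-]; apply: ge_inf => //.
  by exists f => //; exact: tail_hullS Kf.
have hs : has_sup (range (fun m => inf (E m))).
  by split; [exists (inf (E 0%N)); exists 0%N|exists M => _ [m _ <-]].
exists (sup (range (fun m => inf (E m)))) => k e e0.
have [_ [N _ <-] dN] := sup_adherent e0 hs.
(* The index [maxn N k] is at least [k], as required, and past [N], where the infimum already
   exceeds [D - e]. *)
have [_ [f Kf <-] fN] :=
  inf_adherent e0 (conj (E0 (maxn N k)) (hlb (maxn N k))).
exists f, (maxn N k); split.
- exact: leq_maxr.
- exact: Kf.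
- apply: (le_trans (ltW fN)); rewrite lerD2r.
  by apply: ub_le_sup; [exact: hs.2|exists (maxn N k)].
- move=> h Kh; apply: (le_trans (ltW dN)).
  apply: (le_trans (inf_nd _ _ (leq_maxl N k))).
  by apply: ge_inf => //; exists h.
Qed.

Lemma bounded_weak_limit_weighted :
  exists g : T -> R, [/\ measurable_fun [set: T] g,
    {ae mu, forall x, `|g x| <= C} &
    forall phi L, mu.-integrable [set: T] (EFin \o phi) ->
      \int[mu]_x (u k x * phi x) @[k --> \oo] --> L ->
      \int[mu]_x (g x * phi x) = L].
Proof.
have [D HD] := near_minimizers.
(* With tolerance [8^-1 ^+ k], the energy of the increments still decays geometrically after
   multiplication by [4 ^+ k]. *)
have e0 k : 0 < 8^-1 ^+ k :> R by rewrite exprn_gt0// invr_gt0.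
have /choice[F HF] k := HD k _ (e0 k).
have [N {}HF] := choice HF.
have kN k : (k <= N k)%N by have [] := HF k.
have KF k : tail_hull (N k) (F k) by have [] := HF k.
have mF k : measurable_fun [set: T] (F k) by have [] := KF k.
have FC k x : `|F k x| <= C by have [] := KF k.
have dF k : energy (fun x => F k x - F k.+1 x) <= 8 * 8^-1 ^+ k.
  rewrite (energy_parallelogram (KF k) (KF k.+1)).
  have [_ _ Ek lbk] := HF k; have [_ _ Ek1 lbk1] := HF k.+1.
  have e1 : 8^-1 ^+ k.+1 <= 8^-1 ^+ k :> R.
    by rewrite exprS ler_piMl ?(ltW (e0 k))// invf_le1// ler1n.
  (* The midpoint lies in the hull with the smaller index. Nothing orders [N k] and [N k.+1], hence
     the two cases. *)
  have Em : D - 8^-1 ^+ k <= energy (mid (F k) (F k.+1)).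
    have [NN|/ltnW NN] := leqP (N k) (N k.+1).
      by apply: lbk; apply: tail_hull_mid => //; exact: tail_hullS (KF k.+1).
    apply: (@le_trans _ _ (D - 8^-1 ^+ k.+1)); first by rewrite lerD2l lerN2.
    by apply: lbk1; apply: tail_hull_mid => //; exact: tail_hullS (KF k).
  lra.
pose h k x : R := 4 ^+ k * (w x * (F k x - F k.+1 x) ^+ 2).
have h0 k x : 0 <= h k x.
  by rewrite /h mulr_ge0 ?exprn_ge0// mulr_ge0 ?sqr_ge0// ltW.
have mw : measurable_fun [set: T] w.
  by apply/measurable_EFinP; exact: measurable_int iw.
have mh k : measurable_fun [set: T] (h k).
  apply: measurable_funM => //; apply: measurable_funM => //.
  by apply: measurable_funX; exact: measurable_funB.
have iF k : mu.-integrable [set: T]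
    (EFin \o (fun x => (F k x - F k.+1 x) ^+ 2 * w x)).
  apply: (@integrable_energy _ (C + C)); first exact: measurable_funB.
  by move=> x; rewrite (le_trans (ler_normB _ _))// lerD.
have ih : mu.-integrable [set: T] (fun x => \sum_(k <oo) (h k x)%:E)%E.
  (* The value [16] comes from [4 ^+ k * (8 * 8^-1 ^+ k) = 16 / 2 ^ k.+1]. *)
  apply: (@integrable_nneseries _ _ 16) => // k.
  have -> : (\int[mu]_x (h k x)%:E)%E =
      (4 ^+ k * energy (fun x => (F k x - F k.+1 x)))%:E.
    rewrite EFinM /energy fineK; last exact: integrable_fin_num (iF k).
    rewrite -integralZl//; last exact: iF.
    apply: eq_integral => x _.
    by rewrite /h -EFinM; congr (_%:E); ring.
  rewrite lee_fin (@le_trans _ _ (4 ^+ k * (8 * 8^-1 ^+ k)))//.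
    by rewrite ler_pM2l ?exprn_gt0.
  rewrite le_eqVlt; apply/orP; left; apply/eqP.
  rewrite (_ : 8^-1 = 4^-1 * 2^-1 :> R); last by field.
  rewrite natrX exprS exprMn !exprVn.
  by field; rewrite !expf_neq0.
have cF : {ae mu, forall x, cvgn (F ^~ x)}.
  apply: filterS (integrable_ae measurableT ih) => x /(_ I) hx.
  exact: cvg_of_weighted_increments (w0 x) hx.
(* The upper limit is defined and measurable everywhere, and is the limit wherever [F] converges. *)
pose g x := limn_sup (F ^~ x).
have mg : measurable_fun [set: T] g.
  apply: measurable_fun_limn_sup => // x _.
    by exists C => _ [k _ <-]; exact: le_trans (ler_norm _) (FC k x).
  by exists (- C) => _ [k _ <-]; have := FC k x; rewrite ler_norml => /andP[].
have Fg : {ae mu, forall x, F ^~ x @ \oo --> g x}.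
  by apply: filterS cF => x cx; rewrite /g cvg_limn_supE.
exists g; split => //.
- apply: filterS Fg => x /cvg_norm Fx.
  rewrite -(cvg_lim _ Fx)//; apply: limr_le.
    by apply/cvg_ex; eexists; exact: Fx.
  exact: nearW.
- move=> phi L iphi cL.
  have mphi : measurable_fun [set: T] phi.
    by apply/measurable_EFinP; exact: measurable_int iphi.
  have [|||||_ cg] := @cvg_Rintegral_dominated mu
    (fun k x => F k x * phi x) (fun x => g x * phi x) (fun x => `|C * phi x|).
  + by move=> k; exact: measurable_funM.
  + exact: measurable_funM.
  + by apply: filterS Fg => x Fx; apply: cvgM => //; exact: cvg_cst.
  + have : mu.-integrable [set: T] (EFin \o (fun x => C * phi x)).
      exact: integrable_scale.
    by move/integrable_abse.
  + move=> k x; rewrite !normrM ler_wpM2r//.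
    exact: le_trans (FC k x) (ler_norm C).
  (* By domination the pairings of [F k] tend to that of [g]. They also tend to [L], because [F k]
     is in the hull of the tail from [N k >= k]. *)
  suff cFL : \int[mu]_x (F k x * phi x) @[k --> \oo] --> L.
    by rewrite -(cvg_lim _ cg)// (cvg_lim _ cFL).
  apply/cvgrPdist_le => e e1.
  move/cvgrPdist_le: cL => /(_ e e1)[m _ Hm].
  exists m => // k /= mk; rewrite distrC.
  have [_ _] := KF k; apply => // l Nl.
  by rewrite distrC; apply: Hm => /=; exact: leq_trans mk (leq_trans (kN k) Nl).
Qed.

End bounded_sequence.

(** The limit is tested only on those [phi] whose pairings with the whole sequence converge, so no
    subsequence has to be extracted. *)
Lemma bounded_weak_limit (mu : {sigma_finite_measure set T -> \bar R})
    (u : nat -> T -> R) (C : R) :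
  (forall k, measurable_fun [set: T] (u k)) ->
  (forall k x, `|u k x| <= C) ->
  exists g : T -> R, [/\ measurable_fun [set: T] g,
    {ae mu, forall x, `|g x| <= C} &
    forall phi L, mu.-integrable [set: T] (EFin \o phi) ->
      \int[mu]_x (u k x * phi x) @[k --> \oo] --> L ->
      \int[mu]_x (g x * phi x) = L].
Proof.
move=> mu_u uC; have [w [_ w0 iw]] := sigma_finite_weight mu.
exact: bounded_weak_limit_weighted mu_u uC w w0 iw.
Qed.

End weak_star_compactness.

(** * Borel sets, boxes and translation invariance for the Lebesgue measure on ['rV[R]_n] *)

Section lebesgue_rV_theory.
Set Implicit Arguments.
Unset Strict Implicit.
Context {R : realType}.

Lemma measurable_rV_pi n (A : 'I_n -> set R) : (forall i, measurable (A i)) ->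
  measurable [set x : 'rV[R]_n | forall i, A i (x ord0 i)].
Proof.
move=> mA; rewrite (_ : [set _ | _] =
    \bigcap_(i in [set: 'I_n]) [set x : 'rV[R]_n | A i (x ord0 i)]).
  apply: fin_bigcap_measurable => // i _.
  by have := @measurable_coord R n i measurableT (A i) (mA i); rewrite setTI.
by apply/seteqP; split=> [x Ax i _|x Ax i]; [exact: Ax|exact: (Ax i I)].
Qed.

(* An open set is the union of the grid cells of mesh [k.+1^-1] it contains. *)
Lemma open_measurable_rV n (U : set 'rV[R]_n) : open U -> measurable U.
Proof.
move=> oU.
pose cell (p : nat * 'rV[int]_n) := [set x : 'rV[R]_n | forall i,
  `[(p.2 ord0 i)%:~R / p.1.+1%:R, (p.2 ord0 i + 1)%:~R / p.1.+1%:R[%classic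
    (x ord0 i)].
have mcell p : measurable (cell p).
  apply: (@measurable_rV_pi _ (fun i => `[(p.2 ord0 i)%:~R / p.1.+1%:R,
    (p.2 ord0 i + 1)%:~R / p.1.+1%:R[%classic)) => i.
  exact: measurable_itv.
rewrite (_ : U = \bigcup_p (if `[< cell p `<=` U >] then cell p else set0)).
  apply: (@countable_bigcupT_measurable _ 'rV[R]_n (nat * 'rV[int]_n)%type).
    exact: countableP.
  by move=> p; case: ifP.
apply/seteqP; split=> [x Ux|x [p _]]; last first.
  by case: asboolP => // + px; exact.
have /nbhs_ballP[e /= e0 xeU] : nbhs x U by exact: open_nbhs_nbhs.
have [k ke] : exists k : nat, k.+1%:R^-1 < e.
  have [N _ HN] := near_infty_natSinv_lt (PosNum e0).
  by exists N; exact: HN N (leqnn N).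
have k0 : 0 < k.+1%:R :> R by rewrite ltr0n.
pose z : 'rV[int]_n := \row_i Num.floor (k.+1%:R * x ord0 i).
have cx : cell (k, z) x.
  move=> i /=; rewrite in_itv/= mxE ler_pdivrMr// ltr_pdivlMr//.
  by rewrite [x _ _ * _]mulrC floor_itv.
exists (k, z) => //; case: asboolP => // -[].
move=> y cy; apply: xeU; split=> // i j.
rewrite ord1 /ball/=; apply: le_lt_trans ke.
have := cx j; have := cy j; rewrite /= !in_itv/= => /andP[y1 y2] /andP[x1 x2].
rewrite intrD mulrDl mul1r in x2 y2.
set a := _ / _ in x1 x2 y1 y2; set c := _^-1 in x2 y2 *.
by rewrite ler_norml; apply/andP; split; lra.
Qed.

Lemma continuous_measurable_rV n (f : 'rV[R]_n -> R) : continuous f ->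
  measurable_fun [set: 'rV[R]_n] f.
Proof.
move=> cf; apply: (measurability _ (RGenOpens.measurableE R)).
move=> _ [_ [a [b ->] <-]]; rewrite setTI; apply: open_measurable_rV.
by apply: open_comp => // x _; exact: cf.
Qed.

Definition rV_box n (M : R) : set 'rV[R]_n :=
  [set x | forall i, `[- M, M]%classic (x ord0 i)].

Lemma measurable_rV_box n (M : R) : measurable (@rV_box n M).
Proof.
apply: (@measurable_rV_pi _ (fun=> `[- M, M]%classic)) => i.
exact: measurable_itv.
Qed.

Lemma lebesgue_rV_box_lty n (M : R) : (lebesgue_rV n (@rV_box n M) < +oo)%E.
Proof.
elim: n => [|n IH].
  by rewrite /= diracE ltry.
rewrite /= /lebesgue_rVS /pushforward.
rewrite (_ : _ @^-1` _ = `[- M, M]%classic `*` @rV_box n M); last first.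
  apply/seteqP; split => [[t y] /= H|[t y] /= [Ht Hy] i].
    split; first by have := H ord0; rewrite rV_cons0.
    by move=> i; have := H (lift ord0 i); rewrite rV_consS.
  by case: (unliftP ord0 i) => [j|] ->; rewrite ?rV_consS ?rV_cons0.
rewrite product_measure1E//; last exact: measurable_rV_box.
rewrite lte_mul_pinfty//.
  rewrite ge0_fin_numE//= lebesgue_measure_itv/=.
  by case: ifP => _; rewrite ltry.
Qed.

(** The translated measure gives half-open intervals their length, which characterizes the Lebesgue
    measure. *)
Lemma lebesgue_measure_shift (a : R) (A : set R) : measurable A ->
  lebesgue_measure ((fun x => x + a) @^-1` A) = lebesgue_measure A.
Proof.
move=> mA.
have ma : measurable_fun [set: measurableTypeR R]
    ((fun x => x + a) : measurableTypeR R -> measurableTypeR R).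
  exact: measurable_funD.
transitivity (pushforward lebesgue_measure
   ((fun x => x + a) : measurableTypeR R -> measurableTypeR R) A) => //.
apply/esym/lebesgue_measure_unique => //= _ [[b c]] _ <-.
rewrite /pushforward.
rewrite (_ : _ @^-1` _ = `]b - a, c - a]%classic); last first.
  by apply/seteqP; split => x /=; rewrite !in_itv/= ltrBlDr lerBrDr.
rewrite !lebesgue_measure_itv/= !lte_fin ltrD2r.
by case: ifP => // _; rewrite -!EFinB; congr (_%:E); ring.
Qed.

Lemma measurable_shift_rV n (h : 'rV[R]_n) :
  measurable_fun [set: 'rV[R]_n] (fun x => x + h).
Proof.
apply: measurable_rVP => i.
rewrite (_ : (fun _ => _) = fun x : 'rV[R]_n => x ord0 i + h ord0 i).
  by apply: measurable_funD => //; exact: measurable_coord.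
by apply/funext => x; rewrite mxE.
Qed.

(** Induction on the dimension: the shift of the last [n] coordinates is absorbed in each section,
    that of the first one in the integral over the sections. *)
Lemma lebesgue_rV_shift n (h : 'rV[R]_n) (A : set 'rV[R]_n) : measurable A ->
  lebesgue_rV n ((fun x => x + h) @^-1` A) = lebesgue_rV n A.
Proof.
elim: n h A => [|n IH] h A mA.
  rewrite (thinmx0 h); congr (lebesgue_rV 0 _).
  by apply/seteqP; split => x /=; rewrite addr0.
rewrite /= /lebesgue_rVS /pushforward /product_measure1.
pose h0 := h ord0 ord0; pose h' : 'rV[R]_n := \row_j h ord0 (lift ord0 j).
have consD t y : rV_cons (t, y) + h = rV_cons (t + h0, y + h').
  apply/rowP => i; rewrite mxE.
  by case: (unliftP ord0 i) => [j|] ->; rewrite ?rV_consS ?rV_cons0//= !mxE.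
pose B := @rV_cons R n @^-1` A.
have mB : measurable B.
  by rewrite -[B]setTI; exact: measurable_rV_cons.
pose F t := lebesgue_rV n (xsection B t).
transitivity (\int[lebesgue_measure]_x F (x + h0)%R)%E.
  apply: eq_integral => t _ /=; rewrite /F.
  rewrite -(IH h' (xsection B _)); last exact: measurable_xsection.
  congr (lebesgue_rV n _); rewrite !xsectionE.
  by apply/seteqP; split => y /=; rewrite /B /= consD.
pose sh : measurableTypeR R -> measurableTypeR R := fun x => x + h0.
have msh : measurable_fun [set: measurableTypeR R] sh by exact: measurable_funD.
transitivity (\int[pushforward lebesgue_measure sh]_x F x)%E.
  by rewrite ge0_integral_pushforward//; exact: measurable_fun_xsection.
by apply: eq_measure_integral => // C mC _; exact: lebesgue_measure_shift.
Qed.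

Lemma ge0_integral_rV_shift n (h : 'rV[R]_n) (f : 'rV[R]_n -> \bar R) :
  measurable_fun [set: 'rV[R]_n] f -> (forall x, 0 <= f x)%E ->
  (\int[lebesgue_rV n]_x f (x + h)%R = \int[lebesgue_rV n]_x f x)%E.
Proof.
move=> mf f0; have mh := measurable_shift_rV h.
transitivity (\int[pushforward (lebesgue_rV n) (fun x => x + h)%R]_x f x)%E.
  by rewrite ge0_integral_pushforward.
by apply: eq_measure_integral => // A mA _; exact: lebesgue_rV_shift.
Qed.

Lemma Rintegral_rV_shift n (h : 'rV[R]_n) (f : 'rV[R]_n -> R) :
  measurable_fun [set: 'rV[R]_n] f ->
  \int[lebesgue_rV n]_x f (x + h) = \int[lebesgue_rV n]_x f x.
Proof.
move=> /measurable_EFinP mf; congr fine; rewrite integralE [RHS]integralE.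
rewrite -(ge0_integral_rV_shift h (measurable_funepos mf)); last first.
  by move=> x; exact: funepos_ge0.
rewrite -(ge0_integral_rV_shift h (measurable_funeneg mf)); last first.
  by move=> x; exact: funeneg_ge0.
by congr (_ - _)%E; apply: eq_integral => x _; rewrite unlock.
Qed.

End lebesgue_rV_theory.

(** * Difference quotients and discrete integration by parts *)

Section difference_quotients.
Set Implicit Arguments.
Unset Strict Implicit.
Context {R : realType} {n : nat}.
Implicit Types (phi w : 'rV[R]_n -> R) (e x : 'rV[R]_n) (M : R).

Lemma continuous_rV_box_bounded w M : continuous w ->
  exists2 B : R, 0 <= B & forall x, rV_box M x -> `|w x| <= B.
Proof.
move=> cw; have cbox : compact (@rV_box R n M).
  apply: (@rV_compact _ _ (fun=> `[- M, M]%classic)) => i.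
  exact: segment_compact.
have /compact_bounded[B [_ HB]] : compact (w @` (@rV_box R n M)).
  by apply: continuous_compact => //; exact: continuous_subspaceT.
exists (`|B| + 1); first by rewrite addr_ge0.
move=> x xM; apply: (HB (`|B| + 1)); last by exists x.
by rewrite (le_lt_trans (ler_norm B))// ltrDl.
Qed.

Lemma integrable_rV_box_cst M (B : R) :
  (lebesgue_rV n).-integrable [set: 'rV[R]_n]
    (EFin \o (fun x => B * \1_(@rV_box R n M) x)).
Proof.
apply: (integrable_scale (mu := lebesgue_rV n)).
apply/integrableP; split.
  by apply/measurable_EFinP; apply: measurable_indic; exact: measurable_rV_box.
under eq_integral do rewrite /= ger0_norm//.
rewrite integral_indic//; last exact: measurable_rV_box.
by rewrite setIT lebesgue_rV_box_lty.
Qed.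

Lemma integrable_continuous_rV_box w M : continuous w ->
  (forall x, ~ rV_box M x -> w x = 0) ->
  (lebesgue_rV n).-integrable [set: 'rV[R]_n] (EFin \o w).
Proof.
move=> cw w0; have [B B0 HB] := continuous_rV_box_bounded M cw.
apply: (le_integrable _ _ _ (integrable_rV_box_cst M B)) => //.
  by apply/measurable_EFinP; exact: continuous_measurable_rV.
move=> x _; rewrite /= lee_fin indicE [leRHS]ger0_norm ?mulr_ge0//.
case: (boolP (x \in _)) => /= [/set_mem xM|/negP xM].
  by rewrite mulr1 HB.
by rewrite w0 ?normr0 ?mulr0// => xM'; apply: xM; rewrite inE.
Qed.

Lemma continuous_shift_rV w e : continuous w -> continuous (fun x => w (x + e)).
Proof.
move=> cw x; apply: (@continuous_comp _ _ _ (fun x => x + e) w).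
  apply: (@continuousD _ _ _ id (cst e)) => //; exact: cst_continuous.
exact: (cw (x + e)).
Qed.

Lemma continuous_mul_rV w phi : continuous w -> continuous phi ->
  continuous (fun x => w x * phi x).
Proof. by move=> cw cphi x; exact: (cvgM (cw x) (cphi x)). Qed.

Lemma continuous_difference_quotient w e (c : R) : continuous w ->
  continuous (fun x => c * (w (x + e) - w x)).
Proof.
move=> cw; apply: (@continuous_mul_rV (cst c)); first exact: cst_continuous.
by move=> x; exact: (cvgB (continuous_shift_rV (e := e) cw (x := x)) (cw x)).
Qed.

(** Reduces directional derivatives to one variable, for the mean value theorem. *)
Lemma derivable_line phi e x (t : R) : (forall y, derivable phi y e) ->
  is_derive t (1 : R) (fun s : R => phi (x + s *: e)) ('D_e phi (x + t *: e)).
Proof.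
move=> dphi.
have E : (fun h : R => h^-1 *: (((fun s : R => phi (x + s *: e)) \o shift t)
      (h *: (1 : R)) - phi (x + t *: e))) =
    (fun h : R => h^-1 *: ((phi \o shift (x + t *: e)) (h *: e) -
      phi (x + t *: e))).
  apply/funext => h; rewrite /= [h *: 1]mulr1 scalerDl.
  by congr (_ *: (phi _ - _)); rewrite addrCA.
by apply: DeriveDef; rewrite /derivable /derive E//; exact: dphi.
Qed.

Lemma rV_box_shift M M' e x : (forall i, `|e ord0 i| <= M') ->
  rV_box M (x + e) -> rV_box (M + M') x.
Proof.
move=> eM' H i; have := H i; rewrite /= !in_itv/= mxE => /andP[a b].
by have := eM' i; rewrite ler_norml => /andP[c f]; apply/andP; split; lra.
Qed.

(** The mean value theorem on the segment from [x - r *: e] to [x]. As [B] does not depend on [r],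
    the right-hand side can dominate the quotients as the step tends to [0]. *)
Lemma difference_quotient_bounded phi e M : (forall i, `|e ord0 i| <= 1) ->
  (forall x, ~ rV_box M x -> phi x = 0) ->
  (forall x, derivable phi x e) -> continuous ('D_e phi) ->
  exists2 B : R, 0 <= B & forall (r : R) x, 0 < r <= 1 ->
    `|r^-1 * (phi (x - r *: e) - phi x)| <= B * \1_(@rV_box R n (M + 1)) x.
Proof.
move=> e1 phi0 dphi cphi.
(* One unit allows for the step that enlarges the support, the other for the intermediate point
   [x + c *: e]. *)
have [B B0 HB] := continuous_rV_box_bounded (M + 1 + 1) cphi.
have re1 r : 0 <= r <= 1 -> forall i, `|(- (r *: e)) ord0 i| <= 1.
  move=> /andP[r0 r1] i; rewrite !mxE normrN normrM ger0_norm//.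
  by rewrite mulr_ile1.
exists B => // r x /andP[r0 r1]; rewrite indicE.
case: (boolP (x \in _)) => /= [/set_mem xM|/negP xM]; last first.
  have Nx : ~ rV_box M x.
    move=> H; apply: xM; rewrite inE => i; have := H i.
    by rewrite /= !in_itv/= => /andP[? ?]; apply/andP; split; lra.
  rewrite (phi0 _ Nx) phi0 ?subrr ?mulr0 ?normr0// => H; apply: xM; rewrite inE.
  by apply: rV_box_shift H => i; apply: re1; rewrite (ltW r0).
pose g (s : R) := phi (x + s *: e).
have dg (t : R) : is_derive t (1 : R) g ('D_e phi (x + t *: e)).
  exact: derivable_line.
have [||c] := @MVT R g (fun t => 'D_e phi (x + t *: e)) (- r) 0.
- by rewrite oppr_lt0.
- apply: derivable_within_continuous => t _.
  by have [] := dg t.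
rewrite in_itv/= => /andP[c1 c2].
rewrite /g scale0r addr0 sub0r opprK scaleNr => gE.
rewrite -opprB gE mulrN normrN mulrCA mulVf ?gt_eqF// !mulr1 HB//.
have : rV_box (M + 1) ((x + c *: e) + - (c *: e)) by rewrite addrK.
apply: rV_box_shift => i; rewrite !mxE normrN normrM mulr_ile1//.
by rewrite ler_norml; apply/andP; split; lra.
Qed.

(** Up to sign, this is the quotient for the increment [- k.+1%:R^-1]. *)
Lemma cvg_difference_quotient phi e x : derivable phi x e ->
  k.+1%:R * (phi (x - k.+1%:R^-1 *: e) - phi x) @[k --> \oo] --> - 'D_e phi x.
Proof.
move=> dphi.
have /cvgr_dnbhsP H : (fun h : R => h^-1 *: ((phi \o shift x) (h *: e) - phi x))
   @ 0^' --> 'D_e phi x by exact: dphi.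
have {}H := H (fun k => - k.+1%:R^-1).
rewrite (_ : (fun k => _) = (fun k : nat => - ((- k.+1%:R^-1)^-1 *:
    ((phi \o shift x) ((- k.+1%:R^-1) *: e) - phi x)))).
  apply: cvgN; apply: H; split.
    by move=> k; rewrite oppr_eq0 invr_eq0 pnatr_eq0.
  by rewrite -oppr0; apply: cvgN; exact: cvg_harmonic.
apply/funext => k; rewrite invrN invrK /= -mulNr opprK scaleNr.
by rewrite [- _ + x]addrC.
Qed.

(** A translation moves the quotient from [w], which is merely continuous, to [phi], where dominated
    convergence applies. *)
Lemma cvg_Rintegral_difference_quotient w phi e M :
  (forall i, `|e ord0 i| <= 1) ->
  continuous w -> continuous phi ->
  (forall x, ~ rV_box M x -> phi x = 0) ->
  (forall x, derivable phi x e) -> continuous ('D_e phi) ->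
  \int[lebesgue_rV n]_x
     (k.+1%:R * (w (x + k.+1%:R^-1 *: e) - w x) * phi x) @[k --> \oo] -->
  - \int[lebesgue_rV n]_x (w x * 'D_e phi x).
Proof.
move=> e1 cw cphi phi0 dphi cdphi.
have [B B0 HB] := difference_quotient_bounded e1 phi0 dphi cdphi.
have [W W0 HW] := continuous_rV_box_bounded (M + 1) cw.
have r01 k : 0 < (k.+1%:R^-1 : R) <= 1.
  by rewrite invr_gt0 ltr0n invf_le1// ler1n.
have parts k :
    \int[lebesgue_rV n]_x (k.+1%:R * (w (x + k.+1%:R^-1 *: e) - w x) * phi x) =
    \int[lebesgue_rV n]_x
      (w x * (k.+1%:R * (phi (x - k.+1%:R^-1 *: e) - phi x))).
  set h := k.+1%:R^-1 *: e.
  pose F x := w x * phi (x - h).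
  have cF : continuous F.
    by apply: continuous_mul_rV => //; exact: continuous_shift_rV.
  have h1 i : `|(- h) ord0 i| <= 1.
    have /andP[r0 r1] := r01 k.
    by rewrite !mxE normrN normrM mulr_ile1// ger0_norm// ltW.
  have iF : (lebesgue_rV n).-integrable [set: 'rV[R]_n] (EFin \o F).
    apply: (@integrable_continuous_rV_box _ (M + 1)) => // x Nx.
    by rewrite /F phi0 ?mulr0// => H; apply: Nx; exact: rV_box_shift H.
  have iwphi : (lebesgue_rV n).-integrable [set: 'rV[R]_n]
      (EFin \o (fun x => w x * phi x)).
    apply: (@integrable_continuous_rV_box _ M) => [|x Nx].
      exact: continuous_mul_rV.
    by rewrite phi0 ?mulr0.
  have iwphi' : (lebesgue_rV n).-integrable [set: 'rV[R]_n]
      (EFin \o (fun x => w (x + h) * phi x)).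
    apply: (@integrable_continuous_rV_box _ M) => [|x Nx].
      by apply: continuous_mul_rV => //; exact: continuous_shift_rV.
    by rewrite phi0 ?mulr0.
  transitivity (k.+1%:R * (\int[lebesgue_rV n]_x (w (x + h) * phi x) -
      \int[lebesgue_rV n]_x (w x * phi x))).
    rewrite -RintegralB// -RintegralZl//; last first.
      exact: (integrableB measurableT iwphi' iwphi).
    by apply: eq_Rintegral => x _; ring.
  (* Translation invariance is used here: [F (x + h)] is [w (x + h) * phi x]. *)
  transitivity (k.+1%:R * (\int[lebesgue_rV n]_x F x -
      \int[lebesgue_rV n]_x (w x * phi x))).
    congr (_ * (_ - _)).
    rewrite -(Rintegral_rV_shift h (continuous_measurable_rV cF)).
    by apply: eq_Rintegral => x _; rewrite /F addrK.
  rewrite -RintegralB// -RintegralZl//; last first.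
    exact: (integrableB measurableT iF iwphi).
  by apply: eq_Rintegral => x _; rewrite /F; ring.
under eq_fun do rewrite parts.
have [|||||iD cD] := @cvg_Rintegral_dominated _ _ _ (lebesgue_rV n)
  (fun k x => w x * (k.+1%:R * (phi (x - k.+1%:R^-1 *: e) - phi x)))
  (fun x => w x * - 'D_e phi x) (fun x => W * B * \1_(@rV_box R n (M + 1)) x).
- move=> k; apply: continuous_measurable_rV.
  by apply: continuous_mul_rV => //; exact: continuous_difference_quotient.
- apply: continuous_measurable_rV; apply: continuous_mul_rV => // x.
  exact: (cvgN (cdphi x)).
- apply: nearW => x.
  exact: (cvgM (cvg_cst (w x)) (cvg_difference_quotient (dphi x))).
- exact: integrable_rV_box_cst.
- move=> k x; have := HB _ x (r01 k); rewrite invrK indicE.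
  case: (boolP (x \in _)) => /= [/set_mem xM|_]; last first.
    by rewrite !mulr0 normr_le0 => /eqP ->; rewrite mulr0 normr0.
  by rewrite !mulr1 => HBx; rewrite normrM ler_pM// HW.
rewrite (_ : - _ = \int[lebesgue_rV n]_x (w x * - 'D_e phi x))//.
(* The sign passes through the integral thanks to [iD], the integrability of the limit. *)
rewrite -mulN1r (_ : \int[lebesgue_rV n]_x (w x * 'D_e phi x) =
  -1 * \int[lebesgue_rV n]_x (w x * - 'D_e phi x)).
  by rewrite mulrA mulN1r opprK mul1r.
rewrite -RintegralZl//; apply: eq_Rintegral => x _.
by rewrite mulN1r mulrN opprK.
Qed.

End difference_quotients.

(** * Fields of class [R0] and their skew difference quotients *)

Section R0_fields.
Set Implicit Arguments.
Unset Strict Implicit.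
Context {R : realType} {n : nat}.
Implicit Types (v : 'rV[R]_n -> 'rV[R]_n).

Lemma R0_norm_ge0 v : R0 v -> 0 <= R0_norm v.
Proof.
move=> [_ [C C0 HC]]; apply: lb_le_inf; first by exists C.
by move=> ? [].
Qed.

(** Each left-hand side of the condition is a lower bound of the admissible constants, hence at most
    their infimum. *)
Lemma R0_bound_norm v : R0 v -> R0_bound v (R0_norm v).
Proof.
move=> [_ [C C0 HC]] x h k hk h0; apply: lb_le_inf; first by exists C.
by move=> D [_ HD]; exact: HD.
Qed.

Let e (i : 'I_n) : 'rV[R]_n := delta_mx ord0 i.

Lemma dotp_scale_delta (u : 'rV[R]_n) (r : R) i :
  dotp u (r *: e i) = r * u ord0 i.
Proof.
rewrite /dotp (bigD1 i)//= big1 ?addr0 => [|j ji]; rewrite !mxE !eqxx/=.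
  by rewrite mulr1 mulrC.
by rewrite (negPf ji) !mulr0.
Qed.

Lemma enorm_scale_delta (r : R) i : 0 <= r -> enorm (r *: e i) = r.
Proof.
move=> r0; rewrite /enorm dotp_scale_delta !mxE !eqxx mulr1 -expr2.
by rewrite sqrtr_sqr ger0_norm.
Qed.

(** The forward difference quotient, with step [k.+1%:R^-1], of [d_j v_i - d_i v_j]. *)
Definition skew_quotient v (i j : 'I_n) (k : nat) (x : 'rV[R]_n) : R :=
  k.+1%:R * (v (x + k.+1%:R^-1 *: e j) ord0 i - v x ord0 i) -
  k.+1%:R * (v (x + k.+1%:R^-1 *: e i) ord0 j - v x ord0 j).

Lemma skew_quotient_bounded v C i j k x : R0_bound v C ->
  `|skew_quotient v i j k x| <= C.
Proof.
move=> HC; set r : R := k.+1%:R^-1.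
have r0 : 0 < r by rewrite invr_gt0.
(* Both vectors have length [r]: one [r] of the denominator cancels against the pairing, the other
   becomes the factor [k.+1%:R]. *)
have := HC x (r *: e j) (r *: e i).
have rE l := enorm_scale_delta l (ltW r0).
rewrite !rE gt_eqF// => /(_ erefl isT).
rewrite !dotp_scale_delta !invfM !mulrA.
rewrite ![r * _ / _]mulrAC divff ?gt_eqF// !mul1r invrK !mxE.
by rewrite ![_ * k.+1%:R]mulrC.
Qed.

(** The library norm bounding the compact support is the sup norm, so its balls are boxes. *)
Lemma test_function_box phi : test_function phi ->
  exists M : R, forall x : 'rV[R]_n, ~ rV_box M x -> phi x = 0.
Proof.
move=> [_ /compact_bounded[B [_ HB]]]; exists (`|B| + 1) => x Nx.
apply: contrapT => /eqP phix; apply: Nx => i.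
have : `|x| <= `|B| + 1.
  apply: HB; first by rewrite (le_lt_trans (ler_norm B))// ltrDl.
  exact: subset_closure.
move=> xB; rewrite /= in_itv/= -ler_norml; apply: le_trans xB.
rewrite -[leRHS]/(mx_norm x) mx_normrE.
exact: (le_bigmax _ (fun ij : 'I_1 * 'I_n => `|x ij.1 ij.2|) (ord0, i)).
Qed.

Lemma delta_coord_le1 (j i : 'I_n) : `|e j ord0 i| <= 1.
Proof. by rewrite mxE eqxx/=; case: eqP => _; rewrite ?normr1 ?normr0. Qed.

Lemma continuous_coord v l : continuous v -> continuous (fun x => v x ord0 l).
Proof.
move=> cv x; apply: (@continuous_comp _ _ _ v (fun y : 'rV[R]_n => y ord0 l)).
  exact: cv.
exact: coord_continuous.
Qed.

Lemma continuous_skew_quotient v i j k : continuous v ->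
  continuous (skew_quotient v i j k).
Proof.
move=> cv x; pose dq l m := @continuous_difference_quotient R n _
  (k.+1%:R^-1 *: e m) k.+1%:R (@continuous_coord v l cv).
exact: (cvgB (dq i j x) (dq j i x)).
Qed.

Lemma cvg_skew_quotient v (i j : 'I_n) phi :
  continuous v -> test_function phi ->
  \int[lebesgue_rV n]_x (skew_quotient v i j k x * phi x) @[k --> \oo] -->
  skew_jacobian_distr v phi i j.
Proof.
move=> cv tphi; have [M phi0] := test_function_box tphi.
have [sphi _] := tphi.
have cphi : continuous phi.
  by move=> x; exact: differentiable_continuous (sphi [::] x).
have dphi l x : derivable phi x (e l) by exact: diff_derivable (sphi [::] x).
(* Smoothness at the list [[:: l]] makes the first partial derivative differentiable, hence
   continuous. *)
have cdphi l : continuous ('D_(e l) phi).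
  by move=> x; exact: differentiable_continuous (sphi [:: l] x).
have cw l := @continuous_coord v l cv.
have H l m := cvg_Rintegral_difference_quotient (delta_coord_le1 m) (cw l) cphi
  phi0 (dphi m) (cdphi m).
have iq l m k : (lebesgue_rV n).-integrable [set: 'rV[R]_n] (EFin \o (fun x =>
    k.+1%:R * (v (x + k.+1%:R^-1 *: e m) ord0 l - v x ord0 l) * phi x)).
  apply: (@integrable_continuous_rV_box _ _ _ M) => [|x /phi0 ->].
    apply: continuous_mul_rV => //.
    exact: (continuous_difference_quotient (cw l)).
  by rewrite mulr0.
rewrite !mxE.
have -> : (fun k => \int[lebesgue_rV n]_x (skew_quotient v i j k x * phi x)) =
  (fun k => \int[lebesgue_rV n]_x
     (k.+1%:R * (v (x + k.+1%:R^-1 *: e j) ord0 i - v x ord0 i) * phi x) -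
   \int[lebesgue_rV n]_x
     (k.+1%:R * (v (x + k.+1%:R^-1 *: e i) ord0 j - v x ord0 j) * phi x)).
  apply/funext => k; rewrite -RintegralB//.
  by apply: eq_Rintegral => x _; rewrite /skew_quotient mulrBl.
exact: (cvgB (H i j) (H j i)).
Qed.

(** The norm is an essential supremum, or [0] if the whole space is null; the latter case calls for
    [0 <= C]. *)
Lemma Lnorm_oo_le d (T : measurableType d) (mu : {measure set T -> \bar R})
    (f : T -> R) (C : R) : 0 <= C ->
  {ae mu, forall x, `|f x| <= C} -> (Lnorm mu +oo%E (EFin \o f) <= C%:E)%E.
Proof.
move=> C0 fC; rewrite unlock; case: ifPn => _; last by rewrite lee_fin.
apply/ess_supP; apply: filterS fC => x fx /=.
by rewrite lee_fin.
Qed.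

(** There are [n ^ 2] entries, each of square at most [C ^+ 2]. *)
Lemma frob_le (A : 'M[R]_n) (C : R) : 0 <= C -> (forall i j, `|A i j| <= C) ->
  frob A <= n%:R * C.
Proof.
move=> C0 AC; rewrite /frob -[leRHS]ger0_norm ?mulr_ge0// -sqrtr_sqr.
rewrite ler_sqrt ?sqr_ge0//.
apply: (@le_trans _ _ (\sum_(i < n) \sum_(j < n) C ^+ 2)).
  apply: ler_sum => i _; apply: ler_sum => j _.
  by rewrite -[leLHS]ger0_norm ?sqr_ge0// normrX ler_pXn2r// nnegrE.
rewrite !sumr_const !card_ord -mulrnA -[C ^+ 2 *+ _]mulr_natl.
by rewrite natrM exprMn -expr2.
Qed.

End R0_fields.

(** * Assembly of the representing matrix field from its entries *)

Theorem theoremB (R : realType) (n : nat) (hn : (2 <= n)%N) :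
  exists2 C : R, 0 < C &
    forall v : 'rV[R]_n -> 'rV[R]_n, R0 v ->
      exists g : 'rV[R]_n -> 'M[R]_n,
        [/\ Linfty_mx g,
            distr_repr (skew_jacobian_distr v) g &
            (Linfty_norm g <= (C * R0_norm v)%:E)%E].
Proof.
(* The constant is the price of passing from entrywise bounds to the Frobenius norm. *)
exists n%:R; first by rewrite ltr0n (leq_trans _ hn).
move=> v Rv; have C0 := R0_norm_ge0 Rv; have [cv _] := Rv.
have /choice[G HG] : forall p : 'I_n * 'I_n, exists g : 'rV[R]_n -> R,
   [/\ measurable_fun [set: 'rV[R]_n] g,
    {ae lebesgue_rV n, forall x, `|g x| <= R0_norm v} &
    forall phi L, (lebesgue_rV n).-integrable [set: 'rV[R]_n] (EFin \o phi) ->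
      \int[lebesgue_rV n]_x (skew_quotient v p.1 p.2 k x * phi x)
        @[k --> \oo] --> L ->
      \int[lebesgue_rV n]_x (g x * phi x) = L].
  move=> p; apply: bounded_weak_limit => k.
    by apply: continuous_measurable_rV; exact: continuous_skew_quotient.
  by move=> x; apply: skew_quotient_bounded; exact: R0_bound_norm.
pose g x : 'M[R]_n := \matrix_(i, j) G (i, j) x.
have gE i j : (fun x => g x i j) = G (i, j).
  by apply/funext => x; rewrite mxE.
exists g; split.
- move=> i j; rewrite gE; have [mG GC _] := HG (i, j).
  rewrite inE; apply/andP; split; first by rewrite inE.
  by rewrite inE /= /finite_norm (le_lt_trans (Lnorm_oo_le C0 GC))// ltry.
- move=> phi tphi; apply/matrixP => i j; rewrite [RHS]mxE.
  have [_ _ ] := HG (i, j) => /(_ phi) H.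
  under eq_Rintegral do rewrite mxE.
  (* The pairings of the skew quotients with [phi] tend to the entry of the distribution, which is
     therefore the pairing of [G (i, j)]. *)
  apply/esym/H; last exact: cvg_skew_quotient.
  have [M phi0] := test_function_box tphi.
  apply: integrable_continuous_rV_box phi0.
  by move=> x; exact: differentiable_continuous (tphi.1 [::] x).
- apply: Lnorm_oo_le; first by rewrite mulr_ge0.
  (* Finitely many null sets are merged, so that all entries are bounded at the same points. *)
  have : {ae lebesgue_rV n, forall x (p : 'I_n * 'I_n), `|G p x| <= R0_norm v}.
    apply: filter_forall => p; by have [] := HG p.
  apply: filterS => x Gx; rewrite ger0_norm ?sqrtr_ge0//.
  by apply: frob_le => // i j; rewrite mxE.
Qed.
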